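(* Let $S$ be a cancellative semigroup with $Ss\cap St\neq\emptyset$ for all $s,t\in S$, let $Q=S^{-1}S$ be its group of fractions, let $Q$ act by automorphisms of a group $N$, let $G=N\rtimes Q$ be the semidirect product, and let $H$ be a normal subgroup of $N$ such that for every $s\in S$ one has $sH=HsH$ and $HsH$ contains only finitely many right cosets of $H$. Let $\nu$ be a nondegenerate $*$-representation of $c_0(G/H)$, and let $V$ be a unital $*$-representation of the Hecke algebra $\mathcal{H}(G,H)$ on the same Hilbert space. Then $(\nu,V)$ is a covariant pair if and only if (i) $(\nu,V\circ e)$ is covariant for $(c_0(G/H),N/H,\mathrm{rt})$, and (ii) $(\nu,V\circ\mu)$ is Murphy-covariant for $(c_0(G/H),S,\mathrm{rt})$.
   Context: All groups are discrete. Under the hypotheses of the claim, $(G,H)$ is a Hecke pair (every double coset $HxH$ contains only finitely many left cosets of $H$), $Q$ is a group containing $S$, and $N$, $Q$ and $S$ are regarded as subsets of $G$. The Hecke algebra $\mathcal{H}(G,H)$ is the $*$-algebra of finitely supported complex functions on $H\backslash G/H$ with $fg(HxH)=\sum_{yH\in G/H} f(HyH)g(Hy^{-1}xH)$ and $f^*(HxH)=\overline{f(Hx^{-1}H)}$. $[HxH]$ is the characteristic function of $HxH$, $\epsilon_{xH}$ is the characteristic function of the point $xH\in G/H$, and $R(x)=|H\backslash HxH|$ is the number of right cosets of $H$ in $HxH$. The pair $(\nu,V)$ is a covariant pair if for all $a,x,b\in G$ $$V([HaH])\nu(\epsilon_{xH})V([HbH])=\sum_{uH\subseteq Ha^{-1}H,\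 vH\subseteq HbH}\nu(\epsilon_{xuH})V([Hu^{-1}vH])\nu(\epsilon_{xvH}),$$ the sum being over left cosets. For $s\in S$ and $n\in N$ put $\mu_s=R(s)^{-1/2}[HsH]$ and $e(nH)=[HnH]$ in $\mathcal{H}(G,H)$; then $\mu:S\to\mathcal{H}(G,H)$ is a representation of $S$ by algebraic isometries and $e:N/H\to\mathcal{H}(G,H)$ is a unitary representation of $N/H$. Since $s^{-1}Hs\subseteq H$, the formula $(xH)\cdot s=xsH$ is a right action of $S$ on $G/H$, and $\mathrm{rt}$ denotes the action of $S$ by endomorphisms of $c_0(G/H)$ given by $\mathrm{rt}_s(f)(xH)=f(xsH)$. Also $\mathrm{rt}$ denotes the action of $N/H$ by automorphisms of $c_0(G/H)$ given by $\mathrm{rt}_{nH}(f)(xH)=f(xnH)$. If $U$ is a unitary representation of $N/H$, $(\nu,U)$ is covariant for $(c_0(G/H),N/H,\mathrm{rt})$ if $U(nH)\nu(f)U(nH)^*=\nu(\mathrm{rt}_{nH}(f))$ for all $n\in N$, $f\in c_0(G/H)$. If $W$ is a representation of $S$ by isometries, $(\nu,W)$ is Murphy-covariant for $(c_0(G/H),S,\mathrm{rt})$ if $W_s\nu(f)=\nu(\mathrm{rt}_s(f))W_s$ for all $s\in S$, $f\in c_0(G/H)$. *)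

(* Defs.v *)
From HB Require Import structures.
From mathcomp Require Import all_boot all_order all_algebra.
From mathcomp Require Import all_classical all_reals all_analysis.
From mathcomp Require Import finmap complex.

Set Implicit Arguments.
Unset Strict Implicit.
Unset Printing Implicit Defensive.

Import Order.TTheory GRing.Theory Num.Theory.
Import numFieldNormedType.Exports.

Local Open Scope classical_set_scope.
Local Open Scope ring_scope.
Local Open Scope complex_scope.

Section Cosets.
Variables (G : groupType) (H : groupClosed G).
Implicit Types x y : G.

Definition lcos_set x : set G := [set (x * h)%g | h in [set h | h \in H]].
Definition rcos_set x : set G := [set (h * x)%g | h in [set h | h \in H]].
Definition dcos_set x : set G :=
  [set (h * x * k)%g | h in [set h | h \in H] & k in [set k | k \in H]].

(* G/H and H\G/H; their points are subsets of G. *)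
Definition lcosets : Type := range lcos_set.
Definition dcosets : Type := range dcos_set.

Definition lcos x : lcosets := SigSub (mem_set (imageT lcos_set x)).
Definition dcos x : dcosets := SigSub (mem_set (imageT dcos_set x)).

Definition lrepr (A : lcosets) : G := xget 1%g (val A).
Definition drepr (D : dcosets) : G := xget 1%g (val D).

Definition hecke_pair := forall x, finite_set (lcos_set @` dcos_set x).

(* The number R(x) = |H\HxH| of right cosets in HxH. *)
Definition Rindex x : nat := #|` fset_set (rcos_set @` dcos_set x)|.

Lemma lcos_set_refl x : lcos_set x x.
Proof. by exists 1%g; rewrite ?mulg1 //= gpred1. Qed.

Lemma rcos_set_refl x : rcos_set x x.
Proof. by exists 1%g; rewrite ?mul1g //= gpred1. Qed.

Lemma dcos_set_refl x : dcos_set x x.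
Proof.
exists 1%g; rewrite /= ?gpred1//; exists 1%g; rewrite /= ?gpred1//.
by rewrite mul1g mulg1.
Qed.

Lemma lcos_set_eq x h : h \in H -> lcos_set (x * h)%g = lcos_set x.
Proof.
move=> Hh; apply/seteqP; split=> _ [k /= Hk <-].
  by exists (h * k)%g; rewrite /= ?mulgA// gpredM.
by exists (h^-1 * k)%g; rewrite /= ?mulgA ?mulgK// gpredM ?gpredV.
Qed.

Lemma dcos_set_eq x h k : h \in H -> k \in H ->
  dcos_set (h * x * k)%g = dcos_set x.
Proof.
move=> Hh Hk; apply/seteqP; split=> _ [h' /= Hh' [k' /= Hk' <-]].
  exists (h' * h)%g; rewrite /= ?gpredM//.
  by exists (k * k')%g; rewrite /= ?gpredM// !mulgA.
exists (h' * h^-1)%g; rewrite /= ?gpredM ?gpredV//.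
exists (k^-1 * k')%g; rewrite /= ?gpredM ?gpredV//.
by rewrite !mulgA mulgVK mulgK.
Qed.

Lemma lcosM x h : h \in H -> lcos (x * h)%g = lcos x.
Proof. by move=> Hh; apply/val_inj/lcos_set_eq. Qed.

Lemma dcosM x h k : h \in H -> k \in H -> dcos (h * x * k)%g = dcos x.
Proof. by move=> Hh Hk; apply/val_inj/dcos_set_eq. Qed.

Lemma lreprP x : exists2 h, h \in H & lrepr (lcos x) = (x * h)%g.
Proof.
by have [h Hh xhE] := xgetI 1%g (lcos_set_refl x); exists h; rewrite // xhE.
Qed.

Lemma dreprP x :
  exists h k, [/\ h \in H, k \in H & drepr (dcos x) = (h * x * k)%g].
Proof.
by have [h Hh [k Hk xhE]] := xgetI 1%g (dcos_set_refl x); exists h, k; rewrite xhE.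
Qed.

Lemma lreprK A : lcos (lrepr A) = A.
Proof.
have [x ->] : exists x, A = lcos x.
  by case: A => A iA; have [x _ xA] := set_mem iA; exists x; apply/val_inj.
by have [h Hh ->] := lreprP x; rewrite lcosM.
Qed.

Lemma dreprK D : dcos (drepr D) = D.
Proof.
have [x ->] : exists x, D = dcos x.
  by case: D => D iD; have [x _ xD] := set_mem iD; exists x; apply/val_inj.
by have [h [k [Hh Hk ->]]] := dreprP x; rewrite dcosM.
Qed.

End Cosets.
Arguments lcosets {G} H.
Arguments dcosets {G} H.

Section C0.
Variables (R : realType) (T : Type).
Notation C := R[i].

Definition vanishing_at_infty : {pred T -> C} := fun f =>
  `[< forall eps : C, 0 < eps -> finite_set [set t | eps <= `|f t|] >].

Lemma vanishingP (f : T -> C) : reflect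
  (forall eps : C, 0 < eps -> finite_set [set t | eps <= `|f t|])
  (f \in vanishing_at_infty).
Proof. exact: asboolP. Qed.

Lemma vanishing_submod : submod_closed vanishing_at_infty.
Proof.
split=> [|a f g /vanishingP f0 /vanishingP g0]; apply/vanishingP => eps e0.
  rewrite (_ : [set t | _] = set0) //; apply/seteqP; split=> t //=.
  by rewrite normr0 (lt_geF e0).
have a0 : 0 < `|a| + 1 by rewrite ltr_wpDl.
have e1 : 0 < eps / 2 / (`|a| + 1) by rewrite !divr_gt0.
have e2 : 0 < eps / 2 by rewrite divr_gt0.
have : finite_set ([set t | eps / 2 / (`|a| + 1) <= `|f t|] `|`
                   [set t | eps / 2 <= `|g t|]).
  by rewrite finite_setU; split; [exact: f0|exact: g0].
apply: sub_finite_set => t /= et.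
have [|fs] := boolP (eps / 2 / (`|a| + 1) <= `|f t|); first by left.
right; apply: contraLR et => gs.
move: fs gs; rewrite -!real_ltNge ?normr_real ?gtr0_real// => fs gs.
apply: le_lt_trans (ler_normD _ _) _.
rewrite [ltRHS](splitr eps) ler_ltD// normrM.
rewrite ltr_pdivlMr// in fs.
apply: le_trans (ltW fs); rewrite mulrC ler_wpM2l//.
by rewrite lerDl.
Qed.
HB.instance Definition _ :=
  GRing.isSubmodClosed.Build C (T -> C) vanishing_at_infty vanishing_submod.

Record c0 := C0 { c0_fun :> T -> C; _ : c0_fun \in vanishing_at_infty }.
HB.instance Definition _ := [isSub for c0_fun].
HB.instance Definition _ := [Choice of c0 by <:].
HB.instance Definition _ := [SubChoice_isSubLmodule of c0 by <:].

Lemma c0_mul_subproof (f g : c0) : f \* g \in vanishing_at_infty.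
Proof.
case: f g => f /= /vanishingP f0 [g /= /vanishingP g0].
apply/vanishingP => eps e0.
have : finite_set ([set t | eps <= `|f t|] `|` [set t | 1 <= `|g t|]).
  by rewrite finite_setU; split; [exact: f0|exact: g0].
apply: sub_finite_set => t /= et.
have [|fs] := boolP (eps <= `|f t|); first by left.
right; apply: contraLR et => gs.
move: fs gs; rewrite -!real_ltNge ?normr_real ?gtr0_real// => fs gs.
by rewrite normrM -[ltRHS]mulr1 ltr_pM.
Qed.
Definition c0_mul (f g : c0) : c0 := C0 (c0_mul_subproof f g).

Lemma c0_star_subproof (f : c0) :
  (fun t => Num.conj (f t)) \in vanishing_at_infty.
Proof.
case: f => f /= /vanishingP f0; apply/vanishingP => eps e0.
by apply: sub_finite_set (f0 _ e0) => t /=; rewrite norm_conjC.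
Qed.
Definition c0_star (f : c0) : c0 := C0 (c0_star_subproof f).

(* epsilon_t *)
Lemma c0_delta_subproof (t : T) :
  (fun u => (`[< u = t >])%:R : C) \in vanishing_at_infty.
Proof.
apply/vanishingP => eps e0; apply: sub_finite_set (finite_set1 t) => u /=.
by case: asboolP => //= _; rewrite normr0 (lt_geF e0).
Qed.
Definition c0_delta (t : T) : c0 := C0 (c0_delta_subproof t).

End C0.
Arguments c0_delta {R T} t.

Section BoundedOperators.
Variables (R : realType) (E : completeNormedModType R[i]).

Definition bounded_op : {pred E -> E} :=
  fun f => `[< linear f /\ continuous f >].

Lemma bounded_opP (f : E -> E) :
  reflect (linear f /\ continuous f) (f \in bounded_op).
Proof. exact: asboolP. Qed.

Lemma bounded_op_submod : submod_closed bounded_op.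
Proof.
split=> [|a f g /bounded_opP[fl fc] /bounded_opP[gl gc]]; apply/bounded_opP.
  split=> [k x y|x]; first by rewrite scaler0 addr0.
  exact: cvg_cst.
split=> [k x y|x].
  rewrite /= [LHS](_ : _ = a *: f (k *: x + y) + g (k *: x + y))//.
  rewrite [RHS](_ : _ = k *: (a *: f x + g x) + (a *: f y + g y))//.
  rewrite fl gl !scalerDr !scalerA [k * a]mulrC -!addrA; congr (_ + _).
  by rewrite addrCA.
by apply: cvgD; [apply: cvgZl_tmp; exact: fc|exact: gc].
Qed.
HB.instance Definition _ :=
  GRing.isSubmodClosed.Build R[i] (E -> E) bounded_op bounded_op_submod.

Record bop := Bop { bop_fun :> E -> E; _ : bop_fun \in bounded_op }.
HB.instance Definition _ := [isSub for bop_fun].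
HB.instance Definition _ := [Choice of bop by <:].
HB.instance Definition _ := [SubChoice_isSubLmodule of bop by <:].

Variable dot : {dot E for Num.conj}.

(* With completeness of E, this makes (E, dot) a Hilbert space. *)
Definition dot_norm := forall x : E, `|x| ^+ 2 = dot x x.

Definition is_adjoint (A B : E -> E) := forall x y, dot (A x) y = dot x (B y).

(* The adjoint: it exists in a Hilbert space and is unique, [dot] being
   positive definite. *)
Definition adjoint (A : bop) : bop := xget 0 [set B : bop | is_adjoint A B].

Definition c0_star_rep (T : Type) (nu : {linear c0 R T -> bop}) :=
  (forall f g, nu (c0_mul f g) = nu f \o nu g :> (E -> E)) /\
  (forall f, is_adjoint (nu f) (nu (c0_star f))).

(* The scalars of a linear combination are absorbed in the vectors x i. *)
Definition nondegenerate_rep (T : Type) (nu : c0 R T -> bop) :=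
  closure [set v : E | exists (n : nat) (f : 'I_n -> c0 R T) (x : 'I_n -> E),
    v = \sum_(i < n) nu (f i) (x i)] = setT.

End BoundedOperators.

Section Hecke.
Variables (R : realType) (G : groupType) (H : groupClosed G).
Notation C := R[i].

Definition finitely_supported : {pred dcosets H -> C} :=
  fun f => `[< finite_set [set D | f D != 0] >].

Lemma finitely_supportedP (f : dcosets H -> C) :
  reflect (finite_set [set D | f D != 0]) (f \in finitely_supported).
Proof. exact: asboolP. Qed.

Lemma finitely_supported_submod : submod_closed finitely_supported.
Proof.
split=> [|a f g /finitely_supportedP f0 /finitely_supportedP g0];
  apply/finitely_supportedP.
  rewrite (_ : [set D | _] = set0) //; apply/seteqP; split=> t //=.
  by move=> /eqP[].
have : finite_set ([set D | f D != 0] `|` [set D | g D != 0]).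
  by rewrite finite_setU.
apply: sub_finite_set => D /= afgD.
have [f_0|] := eqVneq (f D) 0; last by left.
right; apply: contra_neq afgD => g_0.
by rewrite [LHS](_ : _ = a * f D + g D)// f_0 g_0 mulr0 addr0.
Qed.
HB.instance Definition _ := GRing.isSubmodClosed.Build C (dcosets H -> C)
  finitely_supported finitely_supported_submod.

Record hecke := Hecke {
  hecke_fun :> dcosets H -> C; _ : hecke_fun \in finitely_supported }.
HB.instance Definition _ := [isSub for hecke_fun].
HB.instance Definition _ := [Choice of hecke by <:].
HB.instance Definition _ := [SubChoice_isSubLmodule of hecke by <:].

(* [HxH], for D = HxH *)
Lemma hecke_char_subproof (D : dcosets H) :
  (fun D' => (D' == D)%:R : C) \in finitely_supported.
Proof.
apply/finitely_supportedP; apply: sub_finite_set (finite_set1 D) => D' /=.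
by have [|_] := eqVneq D' D => //; rewrite eqxx.
Qed.
Definition hecke_char D : hecke := Hecke (hecke_char_subproof D).

Lemma hecke_star_subproof (f : hecke) :
  (fun D => Num.conj (f (dcos H (drepr D)^-1))) \in finitely_supported.
Proof.
case: f => f /= /finitely_supportedP f0; apply/finitely_supportedP.
pose i (D : dcosets H) := dcos H (drepr D)^-1%g.
have iK : involutive i.
  move=> D; rewrite -[RHS]dreprK /i.
  have [h [k [Hh Hk ->]]] := dreprP H (drepr D)^-1%g.
  by rewrite !invgM invgK mulgA dcosM ?gpredV.
apply: sub_finite_set (finite_image i f0) => D /=; rewrite conjC_eq0 => fD.
by exists (i D).
Qed.
Definition hecke_star (f : hecke) : hecke := Hecke (hecke_star_subproof f).

Definition convolution (f g : dcosets H -> C) : dcosets H -> C := fun D =>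
  \sum_(A \in [set: lcosets H])
    f (dcos H (lrepr A)) * g (dcos H ((lrepr A)^-1 * drepr D)).

Hypothesis hp : hecke_pair H.

Lemma hecke_mul_subproof (f g : hecke) : convolution f g \in finitely_supported.
Proof.
case: f g => f /= /finitely_supportedP f0 [g /= /finitely_supportedP g0].
apply/finitely_supportedP.
pose F (D1 D2 : dcosets H) := (fun L : set G => dcos H (drepr D1 * xget 1%g L)%g) @`
   (lcos_set H @` dcos_set H (drepr D2)).
have : finite_set (\bigcup_(D1 in [set D | f D != 0])
                   \bigcup_(D2 in [set D | g D != 0]) F D1 D2).
  apply: bigcup_finite => // D1 _; apply: bigcup_finite => // D2 _.
  exact/finite_image/hp.
apply: sub_finite_set => D /=; apply: contra_neqP => Dn.
rewrite /convolution fsbig1// => A _; apply/eqP.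
set y := lrepr A; set x := drepr D.
apply: contra_notT Dn; rewrite mulf_eq0 negb_or => /andP[fy gy].
exists (dcos H y) => //; exists (dcos H (y^-1 * x)%g) => //.
have [h [k [Hh Hk ay]]] := dreprP H y.
have [h' [k' [Hh' Hk' bx]]] := dreprP H (y^-1 * x)%g.
pose a := drepr (dcos H y); pose b := drepr (dcos H (y^-1 * x)%g).
pose z := (k^-1 * (h'^-1 * b))%g.
exists (lcos_set H z).
  exists z => //; exists (k^-1 * h'^-1)%g; rewrite /= ?gpredM ?gpredV//.
  by exists 1%g; rewrite /= ?gpred1// mulg1 /z mulgA.
have [l Hl zl] := lreprP H z.
have -> : xget 1%g (lcos_set H z) = (z * l)%g by [].
rewrite -[RHS]dreprK -/x -/a /z /a ay /b bx.
set w := (X in dcos H X).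
have -> : w = (h * x * (k' * l))%g.
  by rewrite /w !mulgA mulgK mulgVK mulgK.
by rewrite dcosM ?gpredM.
Qed.
Definition hecke_mul (f g : hecke) : hecke := Hecke (hecke_mul_subproof f g).

Variables (E : completeNormedModType C) (dot : {dot E for Num.conj}).

Definition hecke_star_rep (V : {linear hecke -> bop E}) :=
  [/\ V (hecke_char (dcos H 1%g)) = id :> (E -> E),
      forall f g, V (hecke_mul f g) = V f \o V g :> (E -> E) &
      forall f, is_adjoint dot (V f) (V (hecke_star f))].

(* The map xH |-> xgH on G/H; it does not depend on the representatives x when
   g^-1 H g is contained in H, see [right_shiftE]. *)
Definition right_shift (g : G) (A : lcosets H) : lcosets H :=
  lcos H (lrepr A * g)%g.

Lemma right_shiftE g x : (forall h, h \in H -> (h ^ g)%g \in H) ->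
  right_shift g (lcos H x) = lcos H (x * g)%g.
Proof.
move=> Hg; rewrite /right_shift; have [h Hh ->] := lreprP H x.
by rewrite -(lcosM (x * g) (Hg _ Hh)) conjgE !mulgA mulgK.
Qed.

Lemma rt_subproof (g : G) (f : c0 R (lcosets H)) :
  f \o right_shift g \in @vanishing_at_infty R (lcosets H).
Proof.
case: f => f /= /vanishingP f0; apply/vanishingP => eps /f0 fe.
pose F (B : lcosets H) := (fun L : set G => lcos H (lrepr B * xget 1%g L)%g) @`
   (lcos_set H @` dcos_set H g^-1%g).
have : finite_set (\bigcup_(B in [set B | eps <= `|f B|]) F B).
  by apply: bigcup_finite => // B _; exact/finite_image/hp.
apply: sub_finite_set => A /= fA; exists (right_shift g A) => //.
have [h Hh bE] := lreprP H (lrepr A * g)%g.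
pose z := (h^-1 * g^-1)%g.
exists (lcos_set H z).
  exists z => //; exists h^-1%g; rewrite /= ?gpredV//.
  by exists 1%g; rewrite /= ?gpred1// mulg1.
have [l Hl zl] := lreprP H z.
have -> : xget 1%g (lcos_set H z) = (z * l)%g by [].
by rewrite /right_shift bE mulgA lcosM// /z !mulgA !mulgK lreprK.
Qed.
(* rt_g(f)(xH) = f(xgH) *)
Definition rt (g : G) (f : c0 R (lcosets H)) : c0 R (lcosets H) :=
  C0 (rt_subproof g f).

Definition covariant_pair (nu : c0 R (lcosets H) -> bop E)
    (V : hecke -> bop E) := forall a x b : G,
  V (hecke_char (dcos H a)) \o nu (c0_delta (lcos H x))
    \o V (hecke_char (dcos H b)) =
  \sum_(A \in [set A : lcosets H | val A `<=` dcos_set H a^-1%g])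
    \sum_(B \in [set B : lcosets H | val B `<=` dcos_set H b])
      (nu (c0_delta (lcos H (x * lrepr A)%g))
       \o V (hecke_char (dcos H ((lrepr A)^-1 * lrepr B)%g))
       \o nu (c0_delta (lcos H (x * lrepr B)%g))).

End Hecke.
Arguments hecke R {G} H.
Arguments hecke_char {R G H} D.

Record gaction (Q N : groupType) := GAction {
  gact :> Q -> {multiplicative N -> N};
  gact1 : forall n, gact 1%g n = n;
  gactM : forall q r n, gact (q * r)%g n = gact q (gact r n) }.

(* The phantom argument [act] determines the group law. *)
Record sdprod (Q N : groupType) (act : gaction Q N) :=
  SdProd { sdN : N; sdQ : Q }.

Section SemidirectProduct.
Variables (Q N : groupType) (act : gaction Q N).
Notation sdprod := (sdprod act).
Notation SdProd := (SdProd act).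
Local Open Scope group_scope.

Implicit Types x y : sdprod.

Definition sd_pair x := (sdN x, sdQ x).
Definition pair_sd (p : N * Q) := SdProd p.1 p.2.
Lemma sd_pairK : cancel sd_pair pair_sd. Proof. by case. Qed.
HB.instance Definition _ := Choice.copy sdprod (can_type sd_pairK).

Definition sd_one := SdProd 1 1.
Definition sd_mul x y := SdProd (sdN x * act (sdQ x) (sdN y)) (sdQ x * sdQ y).
Definition sd_inv x := SdProd (act (sdQ x)^-1 (sdN x)^-1) (sdQ x)^-1.

Lemma gact_one q : act q 1 = 1.
Proof. by apply: (@mulgI _ (act q 1)); rewrite -gmulfM !mulg1. Qed.

Lemma sd_mulA : associative sd_mul.
Proof.
by move=> [n q] [m r] [l s]; rewrite /sd_mul/= gmulfM gactM !mulgA.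
Qed.
Lemma sd_mul1 : left_id sd_one sd_mul.
Proof. by move=> [n q]; rewrite /sd_mul/= gact1 !mul1g. Qed.
Lemma sd_mulg1 : right_id sd_one sd_mul.
Proof. by move=> [n q]; rewrite /sd_mul/= gact_one !mulg1. Qed.
Lemma sd_mulVg : left_inverse sd_one sd_inv sd_mul.
Proof. by move=> [n q]; rewrite /sd_mul/= -gmulfM !mulVg gact_one. Qed.
Lemma sd_mulgV : right_inverse sd_one sd_inv sd_mul.
Proof. by move=> [n q]; rewrite /sd_mul/= -gactM !mulgV gact1 mulgV. Qed.
HB.instance Definition _ := isGroup.Build sdprod
  sd_mulA sd_mul1 sd_mulg1 sd_mulVg sd_mulgV.

Definition sd_inN (n : N) : sdprod := SdProd n 1.
Definition sd_inQ (q : Q) : sdprod := SdProd 1 q.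

Variable H : groupClosed N.
Definition sd_sub : {pred sdprod} := fun x => (sdN x \in H) && (sdQ x == 1).

Lemma sd_subP x : reflect (exists2 h, h \in H & x = sd_inN h) (x \in sd_sub).
Proof.
apply: (iffP andP) => [|[h Hh ->]]; last by rewrite eqxx.
by case: x => n q /= [Hn /eqP ->]; exists n.
Qed.

Lemma sd_inNM n m : sd_inN (n * m) = sd_inN n * sd_inN m.
Proof. by rewrite -[RHS]/(sd_mul _ _) /sd_mul/= gact1 mulg1. Qed.

Lemma sd_inNV n : sd_inN n^-1 = (sd_inN n)^-1.
Proof.
by apply: (@mulgI _ (sd_inN n)); rewrite mulgV -sd_inNM mulgV.
Qed.

Lemma sd_sub1 : 1 \in sd_sub.
Proof. by apply/sd_subP; exists 1; rewrite ?gpred1. Qed.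
Lemma sd_subV : invg_closed sd_sub.
Proof.
move=> _ /sd_subP[h Hh ->]; apply/sd_subP; exists h^-1; rewrite ?gpredV//.
by rewrite sd_inNV.
Qed.
Lemma sd_subM : mulg_closed sd_sub.
Proof.
move=> _ _ /sd_subP[h Hh ->] /sd_subP[k Hk ->]; apply/sd_subP.
by exists (h * k); rewrite ?gpredM// sd_inNM.
Qed.
(* Packed by hand: HB does not build the join from the three mixins. *)
Definition sd_subgroup : groupClosed sdprod := GroupClosed.Pack
  (GroupClosed.Class (isInvClosed.Build (sdprod : groupType) sd_sub sd_subV)
     (isMul1Closed.Build (sdprod : groupType) sd_sub sd_sub1)
     (isMulClosed.Build (sdprod : groupType) sd_sub sd_subM)).

End SemidirectProduct.
Arguments sd_inN {Q N} act n.
Arguments sd_inQ {Q N} act q.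
Arguments sd_subgroup {Q N} act H.


(* Q = S^-1 S, S being identified with its image by [iota]. *)
Definition group_of_fractions (S : semigroupType) (Q : groupType)
    (iota : {multiplicative S -> Q}) :=
  injective iota /\ forall q : Q, exists s t, q = ((iota s)^-1 * iota t)%g.

Section SemigroupAction.
Variables (S : semigroupType) (Q N : groupType).
Variables (iota : {multiplicative S -> Q}) (act : gaction Q N).
Variable H : groupClosed N.
Notation G := (sdprod act).
Notation HG := (sd_subgroup act H).

Definition sd_inS (s : S) : G := sd_inQ act (iota s).

Definition normal_subgroup := forall n h : N, h \in H -> (h ^ n)%g \in H.

Definition hecke_condition := forall s : S,
  lcos_set HG (sd_inS s) = dcos_set HG (sd_inS s) /\
  finite_set (rcos_set HG @` dcos_set HG (sd_inS s)).

Lemma sd_decomposition : group_of_fractions iota -> forall x : G,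
  exists (s t : S) (n : N), x = ((sd_inS s)^-1 * sd_inN act n * sd_inS t)%g.
Proof.
move=> [_ Qfrac] [n q]; have [s [t ->]] := Qfrac q.
exists s, t, (act (iota s) n); rewrite -mulgA.
apply: (@mulgI _ (sd_inS s)); rewrite mulVKg.
rewrite -[LHS]/(sd_mul _ _) -[RHS]/(sd_mul _ _) /sd_mul/=.
by rewrite gact1 mulVKg !mul1g mulg1.
Qed.

Lemma sd_hecke_pair :
  group_of_fractions iota -> normal_subgroup -> hecke_condition ->
  hecke_pair HG.
Proof.
move=> Qfrac Hn HS x; have [s [t [n ->]]] := sd_decomposition Qfrac x.
have HGn (h : G) : h \in HG ->
    exists2 k, k \in HG & (h * sd_inN act n = sd_inN act n * k)%g.
  move=> /sd_subP[k Hk ->]; exists (sd_inN act (k ^ n)%g).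
    by apply/sd_subP; exists (k ^ n)%g; rewrite ?Hn.
  by rewrite -!sd_inNM conjgE mulVKg.
set m := sd_inN act n in HGn *; set s' := sd_inS s; set t' := sd_inS t.
have [_ fs] := HS s.
pose F (L : set G) := lcos_set HG ((xget 1 L)^-1 * m * t')%g.
apply: sub_finite_set (finite_image F fs).
move=> _ [_ [h /= Hh [k /= Hk <-]] <-].
exists (rcos_set HG (s' * h^-1)%g).
  exists (s' * h^-1)%g => //; exists 1%g; first exact: gpred1.
  by exists h^-1%g; [exact: gpredVr|rewrite mul1g].
have [h' /= Hh' zE] := xgetI 1%g (rcos_set_refl HG (s' * h^-1)%g).
rewrite /F -zE !invgM !invgK.
have [l Hl lE] := HGn h'^-1%g (gpredVr h' (Hh' : h' \in HG)).
have : lcos_set HG t' (l * t')%g.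
  have [-> _] := HS t; exists l => //.
  by exists 1%g; [exact: gpred1|rewrite mulg1].
move=> [r /= Hr rE].
rewrite -!mulgA (mulgA h'^-1%g) lE -!mulgA -rE !mulgA.
by rewrite (@lcos_set_eq _ HG _ r)// (@lcos_set_eq _ HG _ k).
Qed.

Variables (R : realType) (E : completeNormedModType R[i]).
Variable dot : {dot E for Num.conj}.
Implicit Type nu : c0 R (lcosets HG) -> bop E.

(* e(nH) = [HnH] *)
Definition hecke_e (A : lcosets H) : hecke R HG :=
  hecke_char (dcos HG (sd_inN act (lrepr A))).

(* mu_s = R(s)^(-1/2) [HsH] *)
Definition hecke_mu (s : S) : hecke R HG :=
  (sqrtC (Rindex HG (sd_inS s))%:R)^-1 *: hecke_char (dcos HG (sd_inS s)).

Variable hp : hecke_pair HG.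

Definition rtN (A : lcosets H) (f : c0 R (lcosets HG)) :=
  rt hp (sd_inN act (lrepr A)) f.
Definition rtS (s : S) (f : c0 R (lcosets HG)) := rt hp (sd_inS s) f.

Definition covariant nu (U : lcosets H -> bop E) := forall (n : N) f,
  U (lcos H n) \o nu f \o adjoint dot (U (lcos H n)) =
  nu (rtN (lcos H n) f) :> (E -> E).

Definition murphy_covariant nu (W : S -> bop E) := forall s f,
  W s \o nu f = nu (rtS s f) \o W s :> (E -> E).

End SemigroupAction.
Arguments hecke_e {Q N} act H {R} A.
Arguments hecke_mu {S Q N} iota act H {R} s.
Arguments murphy_covariant {S Q N} iota {act H R E} hp nu W.

(* Main.v *)
(** Write [T_y] for [nu (epsilon_{yH})] and [A_g] for [V [HgH]].  Both sides say
that the operators [U(y,z) = T_y A_(y^-1 z) T_z], indexed by pairs of cosets,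
behave as matrix units.  Conditions (i) and (ii) amount to
[T_x A_p = T_x A_p T_(xp)] for all [p] in the monoid [P = N (1 u S)], which is
the covariance identity with [a = 1] and [b = p].  Conversely [G = P^-1 P], so
any cosets [y, z, w] can be written [y = xp, z = xq, w = xr] with [p, q, r] in
[P].  Since [[Hp^-1H][HqH]] is a positive multiple of [[Hp^-1qH]], one gets
[U(xp,xq) = A_p^* T_x A_q], and [T_x A_q A_q^* T_x = T_x], because
[[HqH][Hq^-1H] - [H]] is supported on [qHq^-1] minus [H], whence
[U(y,z) U(z,w) = U(y,w)], which is the covariance identity up to expanding
[A_a T_x A_b] along the finitely many left cosets in [Ha^-1H] and [HbH]. *)

Require Import Defs.
From HB Require Import structures.
From mathcomp Require Import all_boot all_order all_algebra.
From mathcomp Require Import all_classical all_reals all_analysis.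
From mathcomp Require Import finmap complex ring.

Set Implicit Arguments.
Unset Strict Implicit.
Unset Printing Implicit Defensive.

Import Order.TTheory GRing.Theory Num.Theory.
Import numFieldNormedType.Exports.

Local Open Scope classical_set_scope.
Local Open Scope ring_scope.
Local Open Scope complex_scope.

(** * Bounded operators, the inner product and adjoints *)

Section BoundedOperatorTheory.
Variables (R : realType) (E : completeNormedModType R[i]).

Lemma bop_linear (A : bop E) : linear A.
Proof. by case: A => A /= /bounded_opP[]. Qed.
HB.instance Definition _ (A : bop E) :=
  GRing.isLinear.Build R[i] E E *:%R (bop_fun A) (bop_linear A).

(** Evaluation at a fixed vector is registered as a linear map so that the generic lemmas on
    additive maps evaluate sums of operators termwise. *)
Definition bop_apply (v : E) (A : bop E) : E := A v.
Lemma bop_apply_linear v : linear (bop_apply v).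
Proof. by []. Qed.
HB.instance Definition _ v :=
  GRing.isLinear.Build R[i] (bop E) E *:%R (bop_apply v) (bop_apply_linear v).

Lemma bop_addE (A B : bop E) v : (A + B) v = A v + B v.
Proof. exact: (raddfD (bop_apply v)). Qed.
Lemma bop_sumE I (r : seq I) (F : I -> bop E) v :
  (\sum_(i <- r) F i) v = \sum_(i <- r) F i v.
Proof. exact: (raddf_sum (bop_apply v)). Qed.

Lemma bopZ (A : bop E) a v : A (a *: v) = a *: A v.
Proof. exact: linearZ. Qed.
Lemma bopD (A : bop E) v w : A (v + w) = A v + A w.
Proof. exact: linearD. Qed.
Lemma bop0 (A : bop E) : A 0 = 0.
Proof. exact: linear0. Qed.
Lemma bop_sum (A : bop E) I (r : seq I) (F : I -> E) :
  A (\sum_(i <- r) F i) = \sum_(i <- r) A (F i).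
Proof. exact: linear_sum. Qed.

Lemma bop_inj (A B : bop E) : A =1 B -> A = B.
Proof. by move=> AB; apply/val_inj/funext. Qed.

Variable dot : {dot E for Num.conj}.

Lemma dotBl u v w : dot (u - v) w = dot u w - dot v w.
Proof. exact: linearBl. Qed.
Lemma dotBr u v w : dot u (v - w) = dot u v - dot u w.
Proof. exact: linearBr. Qed.
Lemma dotZl a v w : dot (a *: v) w = a * dot v w.
Proof. exact: linearZl_LR. Qed.
Lemma dotZr a v w : dot v (a *: w) = a^* * dot v w.
Proof. exact: linearZr_LR. Qed.
Lemma dot_sumr I (r : seq I) (F : I -> E) v :
  dot v (\sum_(i <- r) F i) = \sum_(i <- r) dot v (F i).
Proof. exact: linear_sumr. Qed.
Lemma dot_suml I (r : seq I) (F : I -> E) v :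
  dot (\sum_(i <- r) F i) v = \sum_(i <- r) dot (F i) v.
Proof. exact: (raddf_sum (applyr dot v)). Qed.

(** Positive definiteness, applied to v - w. Operator identities below are often tested weakly
    through it, so that adjoints can be moved across. *)
Lemma dot_inj (v w : E) : (forall u, dot u v = dot u w) -> v = w.
Proof.
move=> vw; apply/eqP; rewrite -subr_eq0 -(dnorm_eq0 dot).
by rewrite dotBr vw subrr.
Qed.

Lemma dot_conj (v w : E) : dot v w = (dot w v)^*.
Proof. by rewrite (hermC dot) expr0 mul1r. Qed.

Lemma is_adjoint_sym (A B : E -> E) : is_adjoint dot A B -> is_adjoint dot B A.
Proof. by move=> AB x y; rewrite dot_conj -AB -dot_conj. Qed.

(** [adjoint] is a choice with default 0; a known adjoint excludes the default, and uniqueness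
    identifies the choice. *)
Lemma adjointE (A B : bop E) : is_adjoint dot A B -> adjoint dot A = B.
Proof.
move=> AB; rewrite /adjoint; case: xgetP => [B' _ AB'|/(_ B)//].
by apply: bop_inj => w; apply: dot_inj => v; rewrite -AB -AB'.
Qed.
End BoundedOperatorTheory.

(** * Functions vanishing at infinity on a discrete set *)

Section C0Theory.
Variables (R : realType) (T : Type).
Notation C := R[i].
Implicit Types (f g : c0 R T) (t : T).

Lemma c0_inj f g : f =1 g -> f = g.
Proof. by move=> fg; apply/val_inj/funext. Qed.

Definition c0_eval t f : C := f t.
Lemma c0_eval_linear t : scalar (c0_eval t).
Proof. by []. Qed.
HB.instance Definition _ t :=
  GRing.isLinear.Build C (c0 R T) C *%R (c0_eval t) (c0_eval_linear t).

Lemma c0_subE f g t : (f - g) t = f t - g t.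
Proof. exact: (raddfB (c0_eval t)). Qed.
Lemma c0_scaleE a f t : (a *: f) t = a * f t.
Proof. by []. Qed.
Lemma c0_sumE I (r : seq I) (F : I -> c0 R T) t :
  (\sum_(i <- r) F i) t = \sum_(i <- r) F i t.
Proof. exact: (raddf_sum (c0_eval t)). Qed.

Lemma c0_deltaE t u : c0_delta t u = (`[< u = t >])%:R :> C.
Proof. by []. Qed.

Lemma c0_mul_delta f t : c0_mul f (c0_delta t) = f t *: c0_delta t.
Proof.
apply: c0_inj => u; rewrite c0_scaleE /=.
by case: asboolP => [->|_]; rewrite ?mulr0.
Qed.

Lemma c0_mulC f g : c0_mul f g = c0_mul g f.
Proof. by apply: c0_inj => t; rewrite /= mulrC. Qed.

Lemma c0_star_delta t : c0_star (c0_delta t) = c0_delta t :> c0 R T.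
Proof. by apply: c0_inj => u; rewrite /= conjC_nat. Qed.

(* [eps - h] is the square root of [eps^2 - |f|^2], taken in the unitization. *)
Lemma c0_sqrt_ex f (eps : C) : 0 < eps -> (forall t, `|f t| <= eps) ->
  exists2 h : c0 R T, c0_star h = h &
    c0_mul (c0_star f) f = (2 * eps) *: h - c0_mul h h.
Proof.
move=> e0 fe; pose h t : C := eps - sqrtC (eps ^+ 2 - `|f t| ^+ 2).
have d0 t : 0 <= eps ^+ 2 - `|f t| ^+ 2.
  by rewrite subr_ge0 ler_pXn2r// nnegrE ltW.
have h0 t : 0 <= h t.
  rewrite /h subr_ge0 -[leRHS](sqrCK (ltW e0)) ler_sqrtC ?nnegrE//.
    by rewrite gerBl exprn_ge0.
  by rewrite exprn_ge0// ltW.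
(* This bound makes [h] vanish at infinity. It amounts to (eps - |f|)^2 <= eps^2 - |f|^2, where the
   difference is 2 |f| (eps - |f|). *)
have hf t : h t <= `|f t|.
  have ef : 0 <= eps - `|f t| by rewrite subr_ge0.
  rewrite /h lerBlDr -lerBlDl -[leLHS](sqrCK ef) ler_sqrtC ?nnegrE ?exprn_ge0//.
  rewrite sqrrB -subr_ge0.
  rewrite (_ : _ - _ = (eps - `|f t|) * `|f t| *+ 2); last first.
    by rewrite mulrBl; ring.
  by rewrite mulrn_wge0// mulr_ge0.
have hv : h \in @vanishing_at_infty R T.
  have /vanishingP f0 := valP f.
  apply/vanishingP => d /f0; apply: sub_finite_set => t /=.
  by rewrite ger0_norm// => /le_trans; apply.
exists (C0 hv).
  by apply: c0_inj => t; apply: geC0_conj; exact: h0.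
apply: c0_inj => t; rewrite c0_subE c0_scaleE /=.
rewrite mulrC -normCK.
have -> : `|f t| ^+ 2 = eps ^+ 2 - (eps - h t) ^+ 2.
  by rewrite /h subKr sqrtCK subKr.
by ring.
Qed.
End C0Theory.

(** * Nondegenerate representations of c_0 and their point projections *)

Section C0Representation.
Variables (R : realType) (E : completeNormedModType R[i]).
Variables (dot : {dot E for Num.conj}) (dotE : dot_norm dot) (T : choiceType).
Variables (nu : {linear c0 R T -> bop E}) (nu_rep : c0_star_rep dot nu).
Notation C := R[i].
Implicit Types (f g : c0 R T) (t : T) (v w : E).

Lemma nu_mul f g v : nu (c0_mul f g) v = nu f (nu g v).
Proof. by rewrite nu_rep.1. Qed.

Lemma nuZ a f v : nu (a *: f) v = a *: nu f v.
Proof. by rewrite linearZ. Qed.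

Lemma nuB f g v : nu (f - g) v = nu f v - nu g v.
Proof. by rewrite linearB. Qed.

(** Positivity of the inner product suffices: as |f|^2 = 2 eps h - h^2, the number eps^2 |v|^2 - |nu
    f v|^2 equals |eps v - nu h v|^2. *)
Lemma nu_contractive f (eps : C) v : 0 < eps -> (forall t, `|f t| <= eps) ->
  `|nu f v| <= eps * `|v|.
Proof.
move=> e0 fe; have [h hh hf] := c0_sqrt_ex e0 fe.
have hA : is_adjoint dot (nu h) (nu h) by rewrite -{2}hh; exact: nu_rep.2.
have nuf : dot (nu f v) (nu f v) =
    2 * eps * dot v (nu h v) - dot (nu h v) (nu h v).
  rewrite nu_rep.2 -nu_mul hf nuB nuZ dotBr dotZr nu_mul hA.
  by rewrite geC0_conj// mulr_ge0// ltW.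
have : 0 <= dot (eps *: v - nu h v) (eps *: v - nu h v) by exact: dnorm_ge0.
rewrite dotBl !dotBr !dotZl !dotZr (geC0_conj (ltW e0)) hA => pos.
rewrite -(@ler_pXn2r _ 2) ?nnegrE ?mulr_ge0// ?(ltW e0)//.
rewrite exprMn !dotE nuf -subr_ge0.
rewrite (le_trans pos)// le_eqVlt; apply/orP; left; apply/eqP.
by rewrite hA; ring.
Qed.

Lemma nu_delta_mul f t v : nu (c0_delta t) (nu f v) = f t *: nu (c0_delta t) v.
Proof. by rewrite -nu_mul c0_mulC c0_mul_delta nuZ. Qed.

Lemma nu_mul_delta f t v : nu f (nu (c0_delta t) v) = f t *: nu (c0_delta t) v.
Proof. by rewrite -nu_mul c0_mul_delta nuZ. Qed.

Lemma nu_delta_self_adjoint t :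
  is_adjoint dot (nu (c0_delta t)) (nu (c0_delta t)).
Proof. by rewrite -{2}c0_star_delta; exact: nu_rep.2. Qed.

(** Finitely supported functions are uniformly dense in c_0, and [nu] is contractive. *)
Lemma nu_deltas_eq0 v : (forall t, nu (c0_delta t) v = 0) ->
  forall f, nu f v = 0.
Proof.
move=> v0 f; apply/eqP; rewrite -normr_le0; apply/ler_addgt0Pl => eps e0.
rewrite addr0; set d := eps / (`|v| + 1).
have v1 : 0 < `|v| + 1 by rewrite ltr_wpDl.
have d0 : 0 < d by rewrite divr_gt0.
have finf : finite_set [set t | d <= `|f t|].
  by have /vanishingP := valP f; exact.
pose g : c0 R T := \sum_(t <- fset_set [set t | d <= `|f t|]) f t *: c0_delta t.
have nug : nu g v = 0.
  rewrite /g linear_sum bop_sumE big1// => t _.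
  by rewrite nuZ v0 scaler0.
have gE t : g t = if d <= `|f t| then f t else 0.
  rewrite /g c0_sumE.
  have [dt|dt] := boolP (d <= `|f t|).
    have tF : t \in fset_set [set t | d <= `|f t|].
      by rewrite in_fset_set//; apply/mem_set.
    rewrite (bigD1_seq t tF (fset_uniq _)) big1 ?Monoid.mulm1.
      by rewrite c0_scaleE c0_deltaE asboolT// mulr1.
    move=> u /eqP ut.
    by rewrite c0_scaleE c0_deltaE asboolF ?mulr0// => tu; apply: ut.
  rewrite big1_seq// => u /andP[_]; rewrite in_fset_set// => /set_mem du.
  rewrite c0_scaleE c0_deltaE asboolF ?mulr0// => tu.
  by apply: (negP dt); rewrite tu.
have -> : nu f v = nu (f - g) v by rewrite nuB nug subr0.
have fgd t : `|(f - g) t| <= d.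
  rewrite c0_subE gE; have [dt|dt] := boolP (d <= `|f t|).
    by rewrite subrr normr0 ltW.
  by rewrite subr0 ltW// real_ltNge ?normr_real// gtr0_real.
apply: (le_trans (nu_contractive _ d0 fgd)).
rewrite /d mulrAC ler_pdivrMr// ler_wpM2l ?(ltW e0)//.
by rewrite lerDl.
Qed.

Hypothesis nondeg : nondegenerate_rep nu.

(** Such a v is orthogonal to the dense span of the ranges of the [nu f]. A point w of this span
    within distance less than |v| of v would satisfy |v|^2 + |w|^2 = |v - w|^2 < |v|^2. *)
Lemma nu_deltas_separate v : (forall t, nu (c0_delta t) v = 0) -> v = 0.
Proof.
move=> /nu_deltas_eq0 v0; apply/eqP; rewrite -normr_eq0.
apply: contraT => nv; have {}nv : 0 < `|v| by rewrite lt_def nv normr_ge0.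
have : closure [set w : E | exists (n : nat) (f : 'I_n -> c0 R T)
    (x : 'I_n -> E), w = \sum_(i < n) nu (f i) (x i)] v.
  by rewrite nondeg.
move=> /(_ _ (nbhsx_ballx v _ nv))[_ [[n [f [x ->]]]]].
rewrite -ball_normE /=; set w := \sum_(i < n) _.
have vw : dot v w = 0.
  rewrite /w dot_sumr big1// => i _.
  by rewrite -(is_adjoint_sym (nu_rep.2 _)) v0 linear0l.
rewrite -(@ltr_pXn2r _ 2) ?nnegrE// !dotE dnormB vw conjC0 addr0 subr0.
by rewrite gtrDl => /lt_geF/negbT/negP[]; exact: dnorm_ge0.
Qed.

Lemma nu_deltas_inj v w :
  (forall t, nu (c0_delta t) v = nu (c0_delta t) w) -> v = w.
Proof.
move=> vw; apply/eqP; rewrite -subr_eq0; apply/eqP.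
by apply: nu_deltas_separate => t; rewrite linearB/= vw subrr.
Qed.
End C0Representation.

(** * Cosets, double cosets, and elements acting from the right on G/H *)

Section CosetTheory.
Variables (G : groupType) (H : groupClosed G).
Implicit Types (x y p q : G) (A : lcosets H) (D : dcosets H).

Lemma lcos_eqP x y : reflect (lcos H x = lcos H y) ((x^-1 * y)%g \in H).
Proof.
apply: (iffP idP) => [Hxy|xy]; first by rewrite -(lcosM x Hxy) mulVKg.
have : lcos_set H x y.
  by rewrite (_ : lcos_set H x = lcos_set H y) ?[LHS](congr1 val xy)//;
    exact: lcos_set_refl.
by move=> [h /= Hh <-]; rewrite mulKg.
Qed.

Lemma lcosMl x y z : lcos H (z * x) = lcos H (z * y) <-> lcos H x = lcos H y.
Proof.
by split=> /lcos_eqP xy; apply/lcos_eqP; rewrite invgM mulgA mulgVK in xy *.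
Qed.

Lemma lcos_lrepr x y : lcos H (x * lrepr (lcos H y)) = lcos H (x * y).
Proof. by apply/lcosMl; rewrite lreprK. Qed.

Lemma dcos_eqP x y :
  dcos H x = dcos H y <-> exists h k, [/\ h \in H, k \in H & y = (h * x * k)%g].
Proof.
split=> [xy|[h [k [Hh Hk ->]]]]; last by rewrite dcosM.
have : dcos_set H x y.
  by rewrite [dcos_set H x](congr1 val xy); exact: dcos_set_refl.
by move=> [h /= Hh [k /= Hk <-]]; exists h, k.
Qed.

Lemma dcosMr x h : h \in H -> dcos H (x * h) = dcos H x.
Proof. by move=> Hh; rewrite -{1}(mul1g x) dcosM// gpred1. Qed.

Lemma dcosMl x h : h \in H -> dcos H (h * x) = dcos H x.
Proof. by move=> Hh; rewrite -{1}(mulg1 (h * x)%g) dcosM// gpred1. Qed.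

Lemma dcosV x y : dcos H x = dcos H y -> dcos H x^-1%g = dcos H y^-1%g.
Proof.
move=> /dcos_eqP[h [k [Hh Hk ->]]].
by rewrite !invgM mulgA dcosM ?gpredV.
Qed.

Lemma lcos_dcos x y : lcos H x = lcos H y -> dcos H x = dcos H y.
Proof. by move=> /lcos_eqP xy; rewrite -(dcosMr x xy) mulVKg. Qed.

Lemma dcos_lrepr x : dcos H (lrepr (lcos H x)) = dcos H x.
Proof. by apply: lcos_dcos; rewrite lreprK. Qed.

(* For these [p], [HpH = pH] and right translation by [p] acts on [G/H]. *)
Definition shifts p := forall h, h \in H -> (h ^ p)%g \in H.

Lemma shiftsM p q : shifts p -> shifts q -> shifts (p * q)%g.
Proof. by move=> Hp Hq h Hh; rewrite conjgM; apply/Hq/Hp. Qed.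

Lemma shifts_lcosM p x y : shifts p ->
  lcos H x = lcos H y -> lcos H (x * p) = lcos H (y * p).
Proof.
move=> Hp /lcos_eqP xy; apply/lcos_eqP.
by move: (Hp _ xy); rewrite conjgE invgM !mulgA.
Qed.

Lemma shifts_dcosP p x : shifts p ->
  dcos H x = dcos H p <-> lcos H p = lcos H x.
Proof.
move=> Hp; split=> [xp|/lcos_dcos->//].
have /dcos_eqP[h [k [Hh Hk ->]]] := esym xp.
apply/lcos_eqP; rewrite !mulgA gpredM//.
by rewrite -mulgA -conjgE Hp.
Qed.

Definition dcos_lcosets p : set (lcosets H) :=
  [set A | dcos H (lrepr A) = dcos H p].

Lemma dcos_lcosetsE p :
  [set A : lcosets H | val A `<=` dcos_set H p] = dcos_lcosets p.
Proof.
apply/seteqP; split=> A; have AE : val A = lcos_set H (lrepr A).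
- by rewrite -{1}(lreprK A).
- rewrite /= AE => /(_ _ (lcos_set_refl H _))[h /= Hh [k /= Hk Ap]].
  by rewrite /dcos_lcosets /= -Ap dcosM.
- by rewrite -{1}(lreprK A).
move=> /= /esym/dcos_eqP[h [k [Hh Hk Ap]]]; rewrite AE Ap => _ [l /= Hl <-].
by exists h => //; exists (k * l)%g; rewrite /= ?gpredM// !mulgA.
Qed.

Lemma lcos_in_dcos x p : dcos_lcosets p (lcos H x) <-> dcos H x = dcos H p.
Proof. by rewrite /dcos_lcosets /= dcos_lrepr. Qed.

Lemma dcos_lcosets_shifts p : shifts p -> dcos_lcosets p = [set lcos H p].
Proof.
move=> Hp; apply/seteqP; split=> A; rewrite -(lreprK A).
  by rewrite /= lcos_in_dcos => /shifts_dcosP->.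
by move=> /= ->; rewrite lcos_in_dcos.
Qed.

Lemma dcos_lcosets_finite p : hecke_pair H -> finite_set (dcos_lcosets p).
Proof.
move=> /(_ p)/(finite_image (fun L => lcos H (xget 1%g L))).
apply: sub_finite_set => A /= /esym/dcos_eqP[h [k [Hh Hk Ap]]].
exists (lcos_set H (lrepr A)); last first.
  have -> : lcos_set H (lrepr A) = val A by rewrite -{2}(lreprK A).
  exact: lreprK.
by exists (lrepr A) => //; exists h => //; exists k.
Qed.
End CosetTheory.
Arguments dcos_lcosets {G} H p.

(** * Products of characteristic functions in the Hecke algebra *)

Section HeckeTheory.
Variables (R : realType) (G : groupType) (H : groupClosed G).
Variable hp : hecke_pair H.
Notation C := R[i].
Local Notation chi x := (@hecke_char R G H (dcos H x)).
Implicit Types (f g : hecke R H) (p q x : G) (D : dcosets H).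

Lemma hecke_inj f g : f =1 g -> f = g.
Proof. by move=> fg; apply/val_inj/funext. Qed.

Lemma hecke_charE D D' : hecke_char D D' = (D' == D)%:R :> C.
Proof. by []. Qed.

Lemma hecke_scaleE (a : C) f D : (a *: f) D = a * f D.
Proof. by []. Qed.

Lemma hecke_star_char x : hecke_star (chi x) = chi x^-1.
Proof.
apply: hecke_inj => D; rewrite /= conjC_nat; congr (nat_of_bool _)%:R.
apply/eqP/eqP => [/dcosV|Dx]; first by rewrite invgK dreprK.
by rewrite -(invgK x); apply: dcosV; rewrite dreprK.
Qed.

Lemma hecke_mulE f g D : hecke_mul hp f g D =
  \sum_(A \in [set: lcosets H])
    f (dcos H (lrepr A)) * g (dcos H ((lrepr A)^-1 * drepr D)).
Proof. by []. Qed.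

Lemma hecke_char_mulE p g D : hecke_mul hp (chi p) g D =
  \sum_(A <- fset_set (dcos_lcosets H p)) g (dcos H ((lrepr A)^-1 * drepr D)).
Proof.
transitivity (\sum_(A \in dcos_lcosets H p)
    chi p (dcos H (lrepr A)) * g (dcos H ((lrepr A)^-1 * drepr D))).
  rewrite hecke_mulE; apply/esym/fsbig_widen => // A [_ nAp] /=.
  by rewrite (introF eqP) ?mul0r.
rewrite (fsbig_finite _ _ (dcos_lcosets_finite p hp)); apply: eq_big_seq => A.
rewrite in_fset_set; last exact: dcos_lcosets_finite.
by move=> /set_mem Ap; rewrite hecke_charE Ap eqxx mul1r.
Qed.

(** HpH is the single left coset pH, so convolution by [HpH] is left translation. *)
Lemma hecke_char_shifts_mulE p g D : shifts H p ->
  hecke_mul hp (chi p) g D = g (dcos H (p^-1 * drepr D)).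
Proof.
move=> Hp.
rewrite hecke_char_mulE dcos_lcosets_shifts// fset_set1 big_seq_fset1.
have [h Hh ->] := lreprP H p.
by rewrite invgM -mulgA dcosMl// gpredV.
Qed.

Lemma hecke_char_mul p q : shifts H p -> shifts H q ->
  hecke_mul hp (chi p) (chi q) = chi (p * q).
Proof.
move=> Hp Hq; apply: hecke_inj => D.
rewrite hecke_char_shifts_mulE// !hecke_charE.
congr (nat_of_bool _)%:R.
rewrite -{2}(dreprK D); apply/eqP/eqP => /shifts_dcosP xp; apply/shifts_dcosP.
- exact: shiftsM.
- apply/(lcosMl H _ _ p^-1); rewrite mulKg; exact: xp.
- by [].
- by rewrite -(mulKg p q); apply/lcosMl/xp/shiftsM.
Qed.

(** For q with HqH = qH this is the multiplicity of [Hp^-1qH] in [Hp^-1H][HqH]. *)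
Definition hecke_coef p q : C :=
  \sum_(A <- fset_set (dcos_lcosets H p^-1))
    (lcos H (lrepr A * q) == lcos H (p^-1 * q))%:R.

(** The coset p^-1H itself is counted. *)
Lemma hecke_coef_neq0 p q : shifts H q -> hecke_coef p q != 0.
Proof.
move=> Hq; set X := fset_set (dcos_lcosets H p^-1%g).
have Xp : lcos H p^-1%g \in X.
  rewrite in_fset_set; first exact/mem_set/lcos_in_dcos.
  exact: dcos_lcosets_finite.
rewrite /hecke_coef -/X (bigD1_seq _ Xp (fset_uniq _)) /=.
have -> : lcos H (lrepr (lcos H p^-1) * q) = lcos H (p^-1 * q).
  by apply: shifts_lcosM => //; rewrite lreprK.
by rewrite eqxx gt_eqF// ltr_wpDr// sumr_ge0.
Qed.

(** The product is supported on Hp^-1HqH, which is Hp^-1qH because Hq lies in qH. The hypothesis on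
    [drepr] makes the value there literally [hecke_coef]; p and q are chosen later so that it
    holds. *)
Lemma hecke_charV_mul p q : shifts H p -> shifts H q ->
  drepr (dcos H (p^-1 * q)) = (p^-1 * q)%g ->
  hecke_mul hp (chi p^-1) (chi q) = hecke_coef p q *: chi (p^-1 * q).
Proof.
move=> Hp Hq dE; apply: hecke_inj => D.
rewrite hecke_scaleE hecke_charE hecke_char_mulE.
have AD A x : (dcos H ((lrepr A)^-1 * x) == dcos H q) =
    (lcos H (lrepr A * q) == lcos H x).
  apply/eqP/eqP => [/shifts_dcosP Ax|Ax].
    by rewrite -(mulVKg (lrepr A) x); apply/lcosMl/Ax.
  by apply/shifts_dcosP/(lcosMl H _ _ (lrepr A)); rewrite ?mulVKg.
have [->|nD] := eqVneq D (dcos H (p^-1 * q)).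
  rewrite mulr1 dE; apply: eq_bigr => A _.
  by rewrite hecke_charE AD.
rewrite mulr0 big1_seq// => A /andP[_]; rewrite in_fset_set; last first.
  exact: dcos_lcosets_finite.
move=> /set_mem AX; have /esym/dcos_eqP[h [k [Hh Hk Ap]]] := AX : dcos H _ = _.
rewrite hecke_charE AD (introF eqP)// => AqD; apply/negP: nD; rewrite negbK.
apply/eqP; rewrite -(dreprK D) -(lcos_dcos AqD) Ap -!mulgA dcosMl//.
have -> : (p^-1 * (k * q) = p^-1 * q * k ^ q)%g.
  by rewrite conjgE -!mulgA mulVKg.
by rewrite dcosMr ?Hq.
Qed.
End HeckeTheory.

(** * Covariance at single elements and finite block expansions *)

Section Covariance.
Variables (R : realType) (G : groupType) (H : groupClosed G).
Variable hp : hecke_pair H.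
Variables (E : completeNormedModType R[i]).
Variables (dot : {dot E for Num.conj}) (dotE : dot_norm dot).
Variable nu : {linear c0 R (lcosets H) -> bop E}.
Hypotheses (nu_rep : c0_star_rep dot nu) (nu_nondeg : nondegenerate_rep nu).
Variables (V : {linear hecke R H -> bop E}) (V_rep : hecke_star_rep hp dot V).
Local Notation T x := (nu (c0_delta (lcos H x))).
Local Notation A x := (V (hecke_char (dcos H x))).
Implicit Types (f : c0 R (lcosets H)) (p q x y z g : G) (u v w : E).

Lemma V_char1 v : A 1%g v = v.
Proof. by have [-> _ _] := V_rep. Qed.

Lemma V_mul (F F' : hecke R H) v : V (hecke_mul hp F F') v = V F (V F' v).
Proof. by have [_ -> _] := V_rep. Qed.

Lemma V_scale a (F : hecke R H) v : V (a *: F) v = a *: V F v.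
Proof. by rewrite linearZ. Qed.

Lemma V_char_adj g : is_adjoint dot (A g) (A g^-1).
Proof. by rewrite -hecke_star_char; have [_ _] := V_rep; exact. Qed.

Lemma V_char_adjV g : is_adjoint dot (A g^-1) (A g).
Proof. exact/is_adjoint_sym/V_char_adj. Qed.

Lemma nu_delta_adj x : is_adjoint dot (T x) (T x).
Proof. exact: nu_delta_self_adjoint. Qed.

Lemma V_char_mul p q v : shifts H p -> shifts H q -> A p (A q v) = A (p * q) v.
Proof. by move=> Hp Hq; rewrite -V_mul hecke_char_mul. Qed.

Lemma nu_delta_idem x v : T x (T x v) = T x v.
Proof. by rewrite (nu_mul_delta nu_rep) c0_deltaE asboolT// scale1r. Qed.

Lemma nu_delta_orth x y v : lcos H x <> lcos H y -> T x (T y v) = 0.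
Proof.
move=> xy; rewrite (nu_mul_delta nu_rep) c0_deltaE.
by rewrite asboolF ?scale0r// => /esym.
Qed.

Lemma nu_delta_inj v w : (forall x, T x v = T x w) -> v = w.
Proof.
move=> vw; apply: (nu_deltas_inj dotE nu_rep nu_nondeg) => t.
by rewrite -(lreprK t).
Qed.

Definition covariant_at p := forall x v, T x (A p v) = T x (A p (T (x * p) v)).

(** With A_g seen as a matrix over the blocks T_x, this confines its entries to the support of the
    convolution kernel of [HgH]. *)
Definition supported_at g := forall x y v,
  dcos H (x^-1 * y) <> dcos H g -> T x (A g (T y v)) = 0.

(** Links (i) and (ii) to the one-coset identity. Compression by T_x turns [nu f] into the scalar
    f(xp) on both sides; conversely, take for f the point mass at xpH, whose translate is 1 at
    xH. *)
Lemma covariant_atP p : shifts H p ->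
  covariant_at p <-> forall f v, A p (nu f v) = nu (rt hp p f) (A p v).
Proof.
move=> Hp; have rtE f x : rt hp p f (lcos H x) = f (lcos H (x * p)).
  by rewrite /= right_shiftE.
split=> [cp f v|cp x v].
  apply: nu_delta_inj => x; rewrite cp !(nu_delta_mul nu_rep) rtE.
  by rewrite !bopZ -cp.
have : T x (nu (rt hp p (c0_delta (lcos H (x * p)))) (A p v)) = T x (A p v).
  by rewrite (nu_delta_mul nu_rep) rtE c0_deltaE asboolT// scale1r.
by rewrite -cp.
Qed.

(** Insert T_(xp) between A_p and A_q, pass it on to T_(xpq), then remove it. *)
Lemma covariant_atM p q : shifts H p -> shifts H q ->
  covariant_at p -> covariant_at q -> covariant_at (p * q).
Proof.
move=> Hp Hq cp cq x v.
by rewrite -!V_char_mul// cp cq -cp mulgA.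
Qed.

(** The adjoint form of covariance at p: A_(p^-1) maps the range of T_x into that of T_(xp). *)
Lemma covariant_at_adj p x v : covariant_at p ->
  T (x * p) (A p^-1 (T x v)) = A p^-1 (T x v).
Proof.
move=> cp; apply: (dot_inj (dot := dot)) => u.
by rewrite -!(nu_delta_adj, V_char_adj) -cp.
Qed.

Lemma covariant_at_supported p : shifts H p -> covariant_at p -> supported_at p.
Proof.
move=> Hp cp x y v xyp; rewrite cp nu_delta_orth ?bop0// => xpy; apply: xyp.
by apply/shifts_dcosP => //; apply/(lcosMl H _ _ x); rewrite mulVKg.
Qed.

Lemma supported_atV g : supported_at g -> supported_at g^-1.
Proof.
move=> sg x y v xyg; apply: (dot_inj (dot := dot)) => u.
rewrite -nu_delta_adj -V_char_adj -nu_delta_adj sg ?linear0r ?linear0l// => yxg.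
by apply: xyg; rewrite -(invgK (x^-1 * y)%g); apply: dcosV; rewrite invgM invgK.
Qed.

(** HgH has finitely many left cosets, so w has finitely many nonzero blocks; both sides agree after
    applying every T_z. *)
Lemma delta_expansion g x w :
  (forall z, dcos H (x^-1 * z) <> dcos H g -> T z w = 0) ->
  w = \sum_(B <- fset_set (dcos_lcosets H g)) T (x * lrepr B) w.
Proof.
move=> w0; apply: nu_delta_inj => z; rewrite linear_sum /=.
set X := fset_set _; have XE B : B \in X <-> dcos H (lrepr B) = dcos H g.
  rewrite in_fset_set; last exact: dcos_lcosets_finite.
  by split=> [/set_mem//|Bg]; apply/mem_set.
have zB B : lcos H z = lcos H (x * lrepr B) -> B = lcos H (x^-1 * z).
  move=> zxB; rewrite -[LHS]lreprK; apply/(lcosMl H _ _ x).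
  by rewrite mulVKg -zxB.
have [xzg|/w0 zw] := pselect (dcos H (x^-1 * z) = dcos H g).
  have zX : lcos H (x^-1 * z) \in X by apply/XE; rewrite dcos_lrepr.
  rewrite (bigD1_seq _ zX (fset_uniq _)) big1 /= ?addr0.
    by rewrite lcos_lrepr mulVKg nu_delta_idem.
  by move=> B /eqP Bz; rewrite nu_delta_orth// => /zB.
rewrite zw big1_seq// => B /andP[_ /XE BX].
have [/lcos_eqP zxB|] := pselect (lcos H z = lcos H (x * lrepr B)).
  rewrite -(_ : lcos H z = lcos H (x * lrepr B)) ?nu_delta_idem//.
  exact/lcos_eqP.
exact: nu_delta_orth.
Qed.

(** The vector A_(g^-1) T_x u has blocks only over the cosets in xHgH; expand it there and take
    adjoints back. *)
Lemma row_expansion g x v : supported_at g -> T x (A g v) =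
  \sum_(B <- fset_set (dcos_lcosets H g)) T x (A g (T (x * lrepr B) v)).
Proof.
move=> /supported_atV sg; apply: (dot_inj (dot := dot)) => u.
rewrite -nu_delta_adj -V_char_adjV (@delta_expansion g x (A g^-1 (T x u))).
  rewrite dot_suml dot_sumr; apply: eq_bigr => B _.
  by rewrite nu_delta_adj V_char_adjV nu_delta_adj.
move=> z xzg; rewrite sg// => zxg; apply: xzg.
by rewrite -(invgK g) -(invgK (x^-1 * z)%g); apply: dcosV; rewrite invgM invgK.
Qed.

Lemma column_expansion g x v : supported_at g -> A g (T x v) =
  \sum_(B <- fset_set (dcos_lcosets H g^-1)) T (x * lrepr B) (A g (T x v)).
Proof.
move=> sg; apply: delta_expansion => z xzg; rewrite sg// => zxg; apply: xzg.
by rewrite -(invgK (x^-1 * z)%g); apply: dcosV; rewrite invgM invgK.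
Qed.


Lemma hecke_expansion (F : hecke R H) :
  F = \sum_(D <- fset_set [set D | F D != 0]) F D *: hecke_char D.
Proof.
have /finitely_supportedP finf := valP F.
apply: hecke_inj => D.
have -> : (\sum_(D <- fset_set [set D | F D != 0]) F D *: hecke_char D) D =
    \sum_(D' <- fset_set [set D | F D != 0]) F D' * (D == D')%:R.
  elim/big_rec2: _ => // D' z F' _ <-.
  by [].
have [f0|f0] := eqVneq (F D) 0.
  rewrite big1_seq// => D' _; have [<-|_] := eqVneq D D'; last by rewrite mulr0.
  by rewrite f0 mul0r.
have DX : D \in fset_set [set D | F D != 0].
  by rewrite in_fset_set//; apply/mem_set.
rewrite (bigD1_seq _ DX (fset_uniq _)) big1 /= ?addr0 ?eqxx ?mulr1//.
by move=> D' D'D; rewrite eq_sym (negbTE D'D) mulr0.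
Qed.

(** * The matrix unit relation over an abstract monoid of fractions *)

Section FractionMonoid.
Variable P : G -> Prop.
Hypotheses (P_shifts : forall p, P p -> shifts H p).
Hypotheses (P_cov : forall p, P p -> covariant_at p).
Hypotheses (P1 : P 1%g) (PM : forall p q, P p -> P q -> P (p * q)%g).
(** The conjugates php^-1 may leave H, yet they arise both in [HpH][Hp^-1H] and when left cosets of
    Hp^-1H are compared, so covariance must be available for them. *)
Hypothesis (PJ : forall p h, P p -> h \in H -> P (p * h * p^-1)%g).
Hypothesis (P_frac : forall g, exists p q, [/\ P p, P q & g = (p^-1 * q)%g]).

Lemma V_charV_mul p q v : P p -> P q ->
  drepr (dcos H (p^-1 * q)) = (p^-1 * q)%g ->
  A p^-1 (A q v) = hecke_coef R H p q *: A (p^-1 * q) v.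
Proof.
by move=> Pp Pq dE; rewrite -V_mul hecke_charV_mul ?V_scale//; exact: P_shifts.
Qed.

(** Writing the chosen representative of HgH, rather than g, as a fraction supplies the [drepr]
    hypothesis of [hecke_charV_mul]. *)
Lemma dcos_frac g : exists p q, [/\ P p, P q, dcos H g = dcos H (p^-1 * q) &
  drepr (dcos H (p^-1 * q)) = (p^-1 * q)%g].
Proof.
have [p [q [Pp Pq dE]]] := P_frac (drepr (dcos H g)).
by exists p, q; rewrite -dE !dreprK.
Qed.

Lemma P_frac_lcoset p B : dcos_lcosets H p^-1 B ->
  exists2 h, h \in H & B = lcos H (h * p^-1).
Proof.
move=> BX; have /esym/dcos_eqP[h [k [Hh Hk BE]]] := BX : dcos H _ = _.
by exists h; rewrite // -(lreprK B) BE lcosM.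
Qed.

(** A_(p^-1) A_q is a nonzero multiple of A_g. Expanding between the factors over the left cosets B
    of Hp^-1H, a nonzero term would force x^-1 y into BqH, hence into HgH. *)
Lemma supported_at_all g : supported_at g.
Proof.
have [p [q [Pp Pq gE dE]]] := dcos_frac g.
move=> x y v; rewrite gE => xyg.
apply: (scalerI (hecke_coef_neq0 R hp p (P_shifts Pq))).
rewrite scaler0 -bopZ -V_charV_mul//.
rewrite (row_expansion _ _ (supported_atV _)); last first.
  by apply: covariant_at_supported; [exact: P_shifts|exact: P_cov].
rewrite big1_seq// => B /andP[_].
rewrite in_fset_set; last exact: dcos_lcosets_finite.
move=> /set_mem/P_frac_lcoset[h Hh BE].
rewrite (covariant_at_supported (P_shifts Pq) (P_cov Pq)) ?bop0//.
move=> /(shifts_dcosP _ (P_shifts Pq)); rewrite invgM -mulgA => Bxy.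
have {Bxy} : lcos H (lrepr B * q) = lcos H (x^-1 * y).
  by rewrite -[RHS](congr1 (lcos H) (mulVKg (lrepr B) _)); apply/lcosMl.
rewrite (shifts_lcosM (P_shifts Pq) (_ : _ = lcos H (h * p^-1))) ?lreprK//.
by move=> /lcos_dcos xy; apply: xyg; rewrite -xy -mulgA dcosMl.
Qed.

(** Covariance at m and m^-1 gives A_m T_(xm) A_(m^-1) = T_x, and A_(p^-1) absorbs A_m. *)
Lemma V_charV_delta_conj p h x v : P p -> h \in H ->
  let m := (p * h * p^-1)%g in
  A p^-1 (T (x * m) (A m^-1 v)) = A p^-1 (T x v).
Proof.
move=> Pp Hh m.
have Pm : P m by exact: PJ.
have mV : m^-1%g = (p * h^-1 * p^-1)%g by rewrite !invgM !invgK mulgA.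
have Pm' : P m^-1 by rewrite mV; apply: PJ; rewrite // gpredV.
(* p^-1 need not satisfy [shifts], so the product is computed on the adjoint side, where m^-1 p = p
   h^-1. *)
have mp w : A p^-1 (A m w) = A p^-1 w.
  apply: (dot_inj (dot := dot)) => u.
  rewrite -!V_char_adj -(V_char_adjV m) V_char_mul; [|exact: P_shifts..].
  by rewrite mV mulgVK dcosMr ?gpredV.
rewrite -[LHS]mp.
have := covariant_at_adj (x * m) (A m^-1 v) (P_cov Pm').
rewrite invgK mulgK => <-.
by rewrite -(P_cov Pm) V_char_mul ?mulgV ?V_char1//; exact: P_shifts.
Qed.

(** Multiply by [hecke_coef] to replace A_(p^-1 q) by A_(p^-1) A_q, and expand in between over the
    left cosets B of Hp^-1H. The terms with Bq in p^-1qH all equal the right-hand side and the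
    others vanish, so their number is the coefficient to cancel. *)
Lemma transition_frac p q x v : P p -> P q ->
  T (x * p) (A (p^-1 * q) (T (x * q) v)) = A p^-1 (T x (A q v)).
Proof.
(* Right multiplication of p and q by elements of H brings p^-1 q to the chosen representative,
   keeping xpH, xqH and the double cosets of p^-1 and q. *)
wlog dE : p q / drepr (dcos H (p^-1 * q)) = (p^-1 * q)%g.
  move=> claim Pp Pq.
  have [h [k [Hh Hk dE]]] := dreprP H (p^-1 * q)%g.
  have PH h' : h' \in H -> P h' by move=> /(PJ P1); rewrite invg1 mul1g mulg1.
  have := claim (p * h^-1)%g (q * k)%g; rewrite !mulgA !invgM invgK.
  have -> : (h * p^-1 * q * k = drepr (dcos H (p^-1 * q)))%g.
    by rewrite dE !mulgA.
  rewrite !dreprK (dcosMl p^-1 Hh) (dcosMr q Hk) (lcosM (x * q) Hk).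
  rewrite (lcosM (x * p) (gpredVr _ Hh)).
  by apply=> //; apply: PM => //; apply: PH; rewrite ?gpredV.
move=> Pp Pq; have Hq := P_shifts Pq.
apply: (scalerI (hecke_coef_neq0 R hp p Hq)).
rewrite -bopZ -V_charV_mul//.
rewrite (row_expansion _ _ (@supported_at_all _)) /hecke_coef scaler_suml.
apply: eq_big_seq => B; rewrite in_fset_set; last exact: dcos_lcosets_finite.
move=> /set_mem/P_frac_lcoset[h Hh BE].
rewrite (P_cov Pq).
(* For B = hp^-1H the middle coset is xmH; [V_charV_delta_conj] brings it back to xH. *)
pose m := (p * h * p^-1)%g.
have xpB : lcos H (x * p * lrepr B) = lcos H (x * m).
  by rewrite /m -!mulgA; apply/lcosMl/lcosMl; rewrite lreprK BE.
have xpBq : lcos H (x * p * lrepr B * q) = lcos H (x * p * (lrepr B * q)).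
  by rewrite mulgA.
have [Bq|Bq] := eqVneq (lcos H (lrepr B * q)) (lcos H (p^-1 * q)); last first.
  rewrite nu_delta_orth ?bop0 ?scale0r// xpBq => xq.
  move/eqP: Bq; apply; apply/(lcosMl H _ _ (x * p)%g).
  by rewrite xq -!mulgA mulVKg.
have {}xpBq : lcos H (x * p * lrepr B * q) = lcos H (x * q).
  rewrite xpBq (_ : x * q = x * p * (p^-1 * q))%g; first exact/lcosMl.
  by rewrite -!mulgA mulVKg.
rewrite scale1r xpBq nu_delta_idem -xpBq -(P_cov Pq) xpB.
rewrite -(V_charV_delta_conj x (A q v) Pp Hh) -/m.
have mp : lcos H (x * m * p) = lcos H (x * p).
  by rewrite /m -!mulgA mulVg mulg1 mulgA (lcosM _ Hh).
rewrite -mp (covariant_at_adj _ _ (P_cov Pp)).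
have Pm' : P m^-1.
  by rewrite /m !invgM !invgK mulgA; apply: PJ; rewrite // gpredV.
rewrite V_char_mul//; last exact: P_shifts.
(* It remains to see m^-1qH = qH, which holds since hp^-1q and p^-1q lie in the same left coset. *)
congr (bop_fun (A p^-1) (bop_fun (T (x * m)) (V (hecke_char _) v))).
apply: lcos_dcos; apply/(lcosMl H _ _ m); rewrite mulVKg.
rewrite /m -!mulgA; apply/(lcosMl H _ _ p^-1%g); rewrite !mulKg.
rewrite -Bq mulgA; apply: (shifts_lcosM Hq); by rewrite lreprK.
Qed.

(** For m = qhq^-1, covariance moves T_x across A_m to T_(xm), orthogonal to T_x unless m is in H;
    only the [H] term of the product contributes. *)
Lemma delta_V_char_compress q x v : P q -> T x (A q (A q^-1 (T x v))) = T x v.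
Proof.
move=> Pq; have Hq := P_shifts Pq.
pose F : hecke R H :=
  hecke_mul hp (hecke_char (dcos H q)) (hecke_char (dcos H q^-1)) -
  hecke_char (dcos H 1%g).
suff f0 : T x (V F (T x v)) = 0.
  have mulE : hecke_mul hp (hecke_char (dcos H q)) (hecke_char (dcos H q^-1)) =
      F + hecke_char (dcos H 1%g) by rewrite subrK.
  by rewrite -V_mul mulE linearD bop_addE bopD f0 add0r V_char1 nu_delta_idem.
rewrite (hecke_expansion F) linear_sum bop_sumE bop_sum.
rewrite big1_seq// => D /andP[_].
have /finitely_supportedP finf := valP F.
rewrite in_fset_set// => /set_mem DX; have FD0 : F D != 0 := DX.
rewrite V_scale bopZ.
have f1E : F D = (dcos H (q^-1 * drepr D) == dcos H q^-1)%:R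
    - (D == dcos H 1%g)%:R.
  rewrite -hecke_charE -(hecke_char_shifts_mulE hp)//.
(* The coefficient of [H] in [HqH][Hq^-1H] is exactly 1, so [F] vanishes at H. *)
have D1 : D <> dcos H 1%g.
  move=> D1; move: FD0; rewrite f1E D1 eqxx.
  have [h [k [Hh Hk ->]]] := dreprP H 1%g.
  by rewrite mulg1 dcosMr ?gpredM// eqxx subrr eqxx.
have /esym/dcos_eqP[h [k [Hh Hk]]] : dcos H (q^-1 * drepr D) = dcos H q^-1.
  apply: contraPP FD0 => /eqP/negbTE; rewrite f1E => ->.
  by rewrite (introF eqP D1) subrr eqxx.
move=> /(congr1 ( *%g q)); rewrite mulVKg !mulgA => DE.
have {}DE : D = dcos H (q * h * q^-1) by rewrite -(dreprK D) DE (dcosMr _ Hk).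
have Pm := PJ Pq Hh.
rewrite DE (P_cov Pm) nu_delta_orth ?bop0 ?scaler0// => /lcos_eqP.
rewrite invgM mulgVK => Hm.
by apply: D1; rewrite DE -[(q * h * q^-1)%g]mul1g dcosMr// -gpredV.
Qed.

Lemma transitionM y z t v :
  T y (A (y^-1 * z) (T z (A (z^-1 * t) (T t v)))) = T y (A (y^-1 * t) (T t v)).
Proof.
have [p1 [q1 [Pp1 Pq1 yz]]] := P_frac (y^-1 * z)%g.
have [q2 [r2 [Pq2 Pr2 zw]]] := P_frac (z^-1 * t)%g.
(* A common left multiple a q1 = b q2 lets both fractions start from the same x. *)
have [a [b [Pa Pb ab]]] := P_frac (q1 * q2^-1)%g.
pose x := (z * q1^-1 * a^-1)%g.
have xq : z = (x * (a * q1))%g by rewrite /x !mulgA !mulgVK.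
have xp : y = (x * (a * p1))%g.
  rewrite /x !mulgA mulgVK -(mulgA z) -[(q1^-1 * p1)%g]invgK invgM invgK -yz.
  by rewrite invgM invgK mulgA mulgV mul1g.
have abq : (a * q1 = b * q2)%g.
  by rewrite -[q1](mulgVK q2) ab !mulgA mulgV mul1g.
have xr : t = (x * (b * r2))%g.
  rewrite -[LHS](mulVKg z) zw {1}xq abq !mulgA mulgK.
  by [].
have VM (a1 a2 : G) : ((x * a1)^-1 * (x * a2) = a1^-1 * a2)%g.
  by rewrite invgM -mulgA mulKg.
have [Pp Pq Pr] : [/\ P (a * p1)%g, P (a * q1)%g & P (b * r2)%g].
  by split; exact: PM.
(* Doubling T_z gives each of the two transitions its own copy. *)
rewrite -[T z (A _ _)]nu_delta_idem xp xq xr !VM.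
by rewrite !transition_frac// delta_V_char_compress.
Qed.

(** Expand T_x A_b over the left cosets B of HbH and A_a T_x over the left cosets C of Ha^-1H;
    [transitionM] at xC, x, xB settles each summand. *)
Lemma covariant_pair_fractions : covariant_pair nu V.
Proof.
move=> a x b; rewrite !dcos_lcosetsE; apply/funext => v /=.
have fin g := dcos_lcosets_finite g hp.
rewrite (row_expansion _ _ (@supported_at_all b)) bop_sum.
rewrite (fsbig_finite _ _ (fin _)) fct_sumE.
under eq_bigr do rewrite (column_expansion _ _ (@supported_at_all a)).
rewrite exchange_big /=; apply: eq_big_seq => C.
rewrite in_fset_set ?fin// => /set_mem CX.
rewrite (fsbig_finite _ _ (fin _)) fct_sumE; apply: eq_big_seq => B.
rewrite in_fset_set ?fin// => /set_mem BX /=.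
have Ca : dcos H ((x * lrepr C)^-1 * x) = dcos H a.
  by rewrite invgM mulgVK -[RHS](congr1 (dcos H) (invgK a)); apply: dcosV.
have Bb : dcos H (x^-1 * (x * lrepr B)) = dcos H b by rewrite mulKg.
have := transitionM (x * lrepr C) x (x * lrepr B) v.
by rewrite Ca Bb invgM -mulgA mulKg.
Qed.
End FractionMonoid.

(** H and HpH = pH are single left cosets, so for a = 1 and b = p the double sum has one term. *)
Lemma covariant_pair_at p : shifts H p -> covariant_pair nu V -> covariant_at p.
Proof.
move=> Hp cov x v; have H1 : shifts H 1%g by move=> h; rewrite conjg1.
have := congr1 (fun F : E -> E => F v) (cov 1%g x p).
rewrite !dcos_lcosetsE invg1 !dcos_lcosets_shifts// !fsbig_set1 /= V_char1.
rewrite !lcos_lrepr mulg1 => ->.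
have [h Hh ->] := lreprP H 1%g; have [k Hk ->] := lreprP H p.
by rewrite mul1g mulgA dcosM ?gpredV.
Qed.

Lemma covariant_at_lcos p q :
  lcos H p = lcos H q -> covariant_at p -> covariant_at q.
Proof.
move=> pq cp x v; rewrite -(lcos_dcos pq) cp.
by have -> : lcos H (x * p) = lcos H (x * q) by apply/lcosMl.
Qed.
End Covariance.

(** * The semidirect product and its monoid N(1 u S) *)

Section Semidirect.
Variables (S : semigroupType) (Q N : groupType).
Variables (iota : {multiplicative S -> Q}) (act : gaction Q N).
Variable H : groupClosed N.
Notation G := (sdprod act).
Notation HG := (sd_subgroup act H).
Hypotheses (Hnormal : normal_subgroup H) (HS : hecke_condition iota act H).

Lemma shifts_sd_inN n : shifts HG (sd_inN act n).
Proof.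
move=> _ /sd_subP[h Hh ->]; apply/sd_subP.
exists (h ^ n)%g; first exact: Hnormal.
by rewrite !conjgE !sd_inNM sd_inNV.
Qed.

Lemma shifts_sd_inS s : shifts HG (sd_inS iota act s).
Proof.
move=> h Hh; have [HsH _] := HS s.
have : lcos_set HG (sd_inS iota act s) (h * sd_inS iota act s)%g.
  rewrite HsH; exists h => //; exists 1%g; first exact: gpred1.
  by rewrite mulg1.
by move=> [k /= Hk hs]; rewrite conjgE -hs mulKg.
Qed.

(** Allows the factor R(s)^(-1/2) to be cancelled from (ii). [fset_set] counts correctly only for
    finite sets, and [HS] gives finiteness. *)
Lemma Rindex_neq0 s : Rindex HG (sd_inS iota act s) != 0%N.
Proof.
have [_ fin] := HS s.
rewrite /Rindex cardfs_eq0; apply/fset0Pn.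
exists (rcos_set HG (sd_inS iota act s)); rewrite in_fset_set//; apply/mem_set.
by exists (sd_inS iota act s) => //; exact: dcos_set_refl.
Qed.

(** S need not have a unit, hence the separate case for N alone. *)
Definition fraction_monoid (x : G) : Prop :=
  (exists n, x = sd_inN act n) \/
  (exists n s, x = (sd_inN act n * sd_inS iota act s)%g).

(** Membership depends only on the Q-component, so closure is checked in Q. *)
Lemma fraction_monoidP x :
  fraction_monoid x <-> sdQ x = 1%g \/ exists s, sdQ x = iota s.
Proof.
split=> [[[n ->]|[n [s ->]]]|]; first by left.
  by right; exists s; rewrite -[LHS]/(1 * iota s)%g mul1g.
case: x => n q /= [->|[s ->]]; first by left; exists n.
right; exists n, s; rewrite -[RHS]/(sd_mul _ _) /sd_mul /=.
by rewrite gact1 mulg1 mul1g.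
Qed.

Lemma sdQM (x y : G) : sdQ (x * y)%g = (sdQ x * sdQ y)%g.
Proof. by []. Qed.

Lemma sdQV (x : G) : sdQ (x^-1)%g = (sdQ x)^-1%g.
Proof. by []. Qed.

Lemma fraction_monoid1 : fraction_monoid 1%g.
Proof. by apply/fraction_monoidP; left. Qed.

Lemma fraction_monoidM x y :
  fraction_monoid x -> fraction_monoid y -> fraction_monoid (x * y)%g.
Proof.
move=> /fraction_monoidP Px /fraction_monoidP Py; apply/fraction_monoidP.
rewrite sdQM; case: Px => [->|[s ->]]; first by rewrite mul1g.
case: Py => [->|[t ->]]; first by rewrite mulg1; right; exists s.
by right; exists (s * t)%g; rewrite gmulfM.
Qed.

Lemma fraction_monoidJ x h :
  fraction_monoid x -> h \in HG -> fraction_monoid (x * h * x^-1)%g.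
Proof.
move=> _ /sd_subP[k _ ->]; apply/fraction_monoidP; left.
by rewrite !sdQM sdQV /= mulg1 mulgV.
Qed.

Lemma fraction_monoid_frac : group_of_fractions iota -> forall g : G,
  exists p q, [/\ fraction_monoid p, fraction_monoid q & g = (p^-1 * q)%g].
Proof.
move=> Qfrac g; have [s [t [n ->]]] := sd_decomposition Qfrac g.
exists (sd_inS iota act s), (sd_inN act n * sd_inS iota act t)%g.
split; last by rewrite mulgA.
  by apply/fraction_monoidP; right; exists s.
by right; exists n, t.
Qed.

Lemma fraction_monoid_shifts x : fraction_monoid x -> shifts HG x.
Proof.
case=> [[n ->]|[n [s ->]]]; first exact: shifts_sd_inN.
by apply: shiftsM; [exact: shifts_sd_inN|exact: shifts_sd_inS].
Qed.
End Semidirect.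
Arguments fraction_monoid {S Q N} iota act x.

(** * Both implications, through covariance at the elements of N and of S *)

Theorem theorem2p1 (R : realType)
  (S : semigroupType)
  (Scancel : left_injective (fun s t : S => (s * t)%g) /\
             right_injective (fun s t : S => (s * t)%g))
  (Sore : forall s t : S,
     range (fun u : S => (u * s)%g) `&` range (fun u : S => (u * t)%g) !=set0)
  (Q : groupType) (iota : {multiplicative S -> Q})
  (Qfrac : group_of_fractions iota)
  (N : groupType) (act : gaction Q N)
  (H : groupClosed N) (Hnormal : normal_subgroup H)
  (HS : hecke_condition iota act H)
  (E : completeNormedModType R[i]) (dot : {dot E for Num.conj})
  (dotE : dot_norm dot)
  (nu : {linear c0 R (lcosets (sd_subgroup act H)) -> bop E})
  (nu_rep : c0_star_rep dot nu) (nu_nondeg : nondegenerate_rep nu)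
  (V : {linear hecke R (sd_subgroup act H) -> bop E})
  (V_rep : hecke_star_rep (sd_hecke_pair Qfrac Hnormal HS) dot V) :
  covariant_pair nu V <->
  covariant dot (sd_hecke_pair Qfrac Hnormal HS) nu
    (V \o hecke_e act H) /\
  murphy_covariant iota (sd_hecke_pair Qfrac Hnormal HS) nu
    (V \o hecke_mu iota act H).
Proof.
set hp := sd_hecke_pair Qfrac Hnormal HS in V_rep *.
set HG := sd_subgroup act H in hp nu nu_rep nu_nondeg V V_rep *.
have sN n : shifts HG (sd_inN act n) by exact: shifts_sd_inN.
have sS s : shifts HG (sd_inS iota act s) by exact: shifts_sd_inS.
(* For n in N the operator A_n is invertible with inverse A_(n^-1), its adjoint; this relates
   conjugation in (i) to intertwining. *)
have VmK n v : V (hecke_char (dcos HG (sd_inN act n)^-1))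
    (V (hecke_char (dcos HG (sd_inN act n))) v) = v.
  by rewrite -sd_inNV (V_char_mul V_rep)// sd_inNV mulVg (V_char1 V_rep).
have VmVK n v : V (hecke_char (dcos HG (sd_inN act n)))
    (V (hecke_char (dcos HG (sd_inN act n)^-1)) v) = v.
  by rewrite -sd_inNV (V_char_mul V_rep)// sd_inNV mulgV (V_char1 V_rep).
split=> [cov|[covN covS]].
  split=> [n f|s f]; apply/funext => v /=.
    rewrite /hecke_e /rtN; set m := sd_inN act _.
    rewrite (adjointE (V_char_adj V_rep m)).
    have /(covariant_atP hp dotE nu_rep nu_nondeg V (sN _)) -> :=
      covariant_pair_at V_rep (sN (lrepr (lcos H n))) cov.
    by rewrite VmVK.
  rewrite /hecke_mu (V_scale V) (V_scale V) bopZ; congr (_ *: _).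
  have /(covariant_atP hp dotE nu_rep nu_nondeg V (sS s)) :=
    covariant_pair_at V_rep (sS s) cov.
  exact.
have cN n : covariant_at nu V (sd_inN act n).
  (* [hecke_e] and [rtN] see only the chosen representative of nH, so covariance is proved there and
     transferred to n. *)
  have [h Hh nE] := lreprP H n.
  apply: (@covariant_at_lcos _ _ _ _ _ _ (sd_inN act (lrepr (lcos H n)))).
    rewrite nE sd_inNM lcosM//; apply/sd_subP.
    by exists h.
  apply/(covariant_atP hp dotE nu_rep nu_nondeg V (sN _)) => f v.
  (* Evaluating (i) at the image of v under the unitary cancels the adjoint. *)
  have := congr1 (fun F : E -> E => F (V (hecke_e act H (lcos H n)) v))
    (covN n f).
  by rewrite /= /hecke_e (adjointE (V_char_adj V_rep _)) VmK.
have cS s : covariant_at nu V (sd_inS iota act s).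
  apply/(covariant_atP hp dotE nu_rep nu_nondeg V (sS s)) => f v.
  have := congr1 (fun F : E -> E => F v) (covS s f).
  rewrite /= /hecke_mu !(V_scale V) bopZ; apply: scalerI.
  by rewrite invr_eq0 sqrtC_eq0 pnatr_eq0 Rindex_neq0.
refine (covariant_pair_fractions dotE nu_rep nu_nondeg V_rep
  (P := fraction_monoid iota act) _ _ _ _ _ _).
- exact: fraction_monoid_shifts.
- move=> p [[n ->]|[n [s ->]]]; first exact: cN.
  exact: (covariant_atM V_rep (sN n) (sS s) (cN n) (cS s)).
- exact: fraction_monoid1.
- exact: fraction_monoidM.
- exact: fraction_monoidJ.
- exact: fraction_monoid_frac.
Qed.
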